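(* Let $L_n=\{(a,0):0\le a\le n-1\}$. There are constants $c_1,c_2>0$ such that for all integers $n\ge2$, $$c_1e^{-n}n^{n+\frac12}\le |\gamma(L_n)|\le c_2\left(\frac{e}{2}\right)^n(n-1)^{n-\frac52}.$$
   Context: A pattern is a finite subset $P\subset\mathbb{Z}^2$. Let $T=\{(0,1),(1,1),(1,0)\}$. A solitaire move applies to $P$ at $v\in\mathbb{Z}^2$ when $|P\cap(v+T)|=2$, and replaces $P$ by $(P\setminus(v+T))\cup S$ for an arbitrary two-element subset $S\subset v+T$; $\gamma(P)$ is the set of patterns reachable from $P$ by finitely many moves. *)

(* Defs.v *)
From HB Require Import structures.
From Stdlib Require Import Relations.
From mathcomp Require Import all_boot all_order all_algebra finmap.
From mathcomp Require Import all_classical all_reals all_analysis.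

Set Implicit Arguments.
Unset Strict Implicit.
Unset Printing Implicit Defensive.

Import GRing.Theory Num.Theory.

Local Open Scope fset_scope.
Local Open Scope ring_scope.

Definition pattern := {fset int * int}.

Definition T : pattern := [fset (0, 1); (1, 1); (1, 0)].

(* [v + t] is the componentwise addition of Z^2 (product Z-module). *)
Definition translate (v : int * int) (A : pattern) : pattern :=
  [fset v + t | t in A].

Definition solitaire_move (P Q : pattern) : Prop :=
  exists (v : int * int) (S : pattern),
    [/\ #|` P `&` translate v T| = 2%N,
        S `<=` translate v T,
        #|` S| = 2%N &
        Q = (P `\` translate v T) `|` S].

(* Zero moves are allowed: [P] belongs to [gamma P]. *)
Definition gamma (P : pattern) : set pattern :=
  [set Q | clos_refl_trans pattern solitaire_move P Q].

Definition L (n : nat) : pattern := [fset (a%:Z, 0) | a in iota 0 n].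

(* Main.v *)
Require Import Defs.
From HB Require Import structures.
From Stdlib Require Import Relations.
From mathcomp Require Import all_boot all_order all_algebra finmap.
From mathcomp Require Import all_classical all_reals all_analysis.
From mathcomp Require Import zify ring lra.

Set Implicit Arguments.
Unset Strict Implicit.
Unset Printing Implicit Defensive.

Import Order.TTheory GRing.Theory Num.Theory.

Local Open Scope fset_scope.
Local Open Scope ring_scope.

(**
Upper bound. A set is fill-closed when it contains a translate of [T] as soon as it contains two of
its points. Moves preserve the cardinality of a pattern and the fill-closed sets containing it, so
every pattern [P] of the orbit has [n] points, and every fill-closed set containing [P] contains
[L n]. Starting from the points of [P], repeatedly replace two touching triangles by the triangle
they span; the size of a triangle never exceeds the number of points it was made of. When no two
triangles touch, their union is fill-closed, so one of them contains [L n]: it is made of all [n]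
points and has size [n], so every merge was tight. Choosing the last merge gives
[N n <= \sum_a 3 a N a N (n - a)] for the number [N n] of such patterns, hence
[N n = O(b ^ n n!)] with [b = 147 / 40 < e ^ 2 / 2].

Lower bound. A full row can be traded for any one of its cells together with the full shorter row
below it; iterating, the [n!] patterns with one point in each row of the triangle are reached, and
[n! >= e ^ (- n) n ^ (n + 1 / 2)].
*)

(** * Triangles and the merging of touching triangles *)

Lemma in_translateT (v p : int * int) :
  (p \in translate v T) =
  [|| p == (v.1, v.2 + 1), p == (v.1 + 1, v.2 + 1) | p == (v.1 + 1, v.2)].
Proof.
case: v p => [x y] [i j]; apply/imfsetP/idP => /=.
  move=> [[a b]] /=; rewrite !inE !xpair_eqE => H [-> ->]; lia.
rewrite !xpair_eqE => H.
exists (i - x, j - y); last by congr (_, _) => /=; lia.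
by rewrite /= !inE !xpair_eqE; lia.
Qed.

(** The triple [(X, Y, W)] encodes the points with x <= X, y <= Y and x + y >= W; [T] itself is
    [(1, 1, 1)]. A positive size is the number of points on a side. *)
Definition triangle := (int * int * int)%type.

Definition in_tri (t : triangle) (p : int * int) : bool :=
  [&& p.1 <= t.1.1, p.2 <= t.1.2 & t.2 <= p.1 + p.2].

Definition tri_size (t : triangle) : int := t.1.1 + t.1.2 - t.2 + 1.

Definition hull (t u : triangle) : triangle :=
  (Num.max t.1.1 u.1.1, Num.max t.1.2 u.1.2, Num.min t.2 u.2).

Definition tri_meet (t u : triangle) : triangle :=
  (Num.min t.1.1 u.1.1, Num.min t.1.2 u.1.2, Num.max t.2 u.2).

(* A nonempty intersection has positive size; size [0] means disjoint but adjacent. *)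
Definition touch (t u : triangle) : bool := 0 <= tri_size (tri_meet t u).

Lemma touchC t u : touch t u = touch u t.
Proof.
case: t u => [[a b] c] [[d e] f]; rewrite /touch /tri_size /tri_meet /=; lia.
Qed.

(** The one-point triangles at two points of a translate of [T] have a meet of size 0 or 1, and
    enlarging them can only increase that size. *)
Lemma touch_translate v p q t u : p \in translate v T -> q \in translate v T ->
  in_tri t p -> in_tri u q -> touch t u.
Proof.
case: v p q t u => [x y] [i j] [i' j'] [[a b] c] [[d e] f].
rewrite !in_translateT !xpair_eqE /in_tri /touch /tri_size /tri_meet /=; lia.
Qed.

Inductive gen : seq (int * int) -> triangle -> Prop :=
| Gen1 p : gen [:: p] (p.1, p.2, p.1 + p.2)
| GenU l t k u : gen l t -> gen k u -> touch t u -> gen (l ++ k) (hull t u).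

Lemma gen_size_gt0 l t : gen l t -> 0 < tri_size t.
Proof.
elim=> {l t} [[i j]|l [[a b] c] k [[d e] f] _ + _ +]; rewrite /tri_size /=; lia.
Qed.

(** Maximum and minimum of two numbers add up to their sum. Touching means a meet of nonnegative
    size, so merging is subadditive in size. *)
Lemma tri_size_hull t u :
  tri_size (hull t u) = tri_size t + tri_size u - tri_size (tri_meet t u).
Proof.
case: t u => [[a b] c] [[d e] f]; rewrite /tri_size /hull /tri_meet /=; lia.
Qed.

Lemma gen_size_le l t : gen l t -> tri_size t <= (size l)%:Z.
Proof.
elim=> {l t} [[i j]|l t k u _ ht _ hu]; first by rewrite /tri_size /=; lia.
rewrite /touch tri_size_hull size_cat; lia.
Qed.

Definition separated (s : seq (seq (int * int) * triangle)) : Prop :=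
  (forall e, e \in s -> gen e.1 e.2) /\
  (forall e f, e \in s -> f \in s -> touch e.2 f.2 -> e.2 = f.2).

(** When [t] touches a triangle of [s], merge the two and insert the hull into the remaining,
    shorter sequence. *)
Lemma separated_insert s l t : separated s -> gen l t ->
  exists2 s', separated s' &
    perm_eq (flatten (map fst s')) (l ++ flatten (map fst s)).
Proof.
have [m] := ubnP (size s); elim: m s l t => // m IH s l t lt_s [gs ns] gl.
case: (boolP (has (fun f => touch t f.2) s)) => [/hasP[f fs tf]|/hasPn nt].
  have ps := perm_to_rem fs.
  have /(_ _ _ _ _ (GenU gl (gs _ fs) tf))[||s' ns' ps'] := IH (rem f s).
  - by rewrite -ltnS (leq_trans _ lt_s)// ltnS size_rem// prednK//; case: s fs {lt_s gs ns ps}.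
  - by split=> [e /mem_rem /gs//|e g /mem_rem es /mem_rem hg]; apply: ns.
  exists s' => //; apply: (perm_trans ps').
  rewrite -catA perm_cat2l.
  by rewrite perm_sym; apply: (perm_trans (perm_flatten (perm_map fst ps))).
exists ((l, t) :: s); last by [].
split=> [e|e f]; rewrite !inE; first by case/predU1P => [->|/gs].
case/predU1P => [->|es] /predU1P[->|fs] //=; last exact: ns.
  by move=> h; move: (nt _ fs); rewrite h.
by rewrite touchC => h; move: (nt _ es); rewrite h.
Qed.

Lemma separated_exists (l : seq (int * int)) :
  exists2 s, separated s & perm_eq (flatten (map fst s)) l.
Proof.
elim: l => [|p l [s ss ps]]; first by exists [::].
have [s' ss' ps'] := separated_insert ss (Gen1 p); exists s' => //.
by apply: (perm_trans ps'); rewrite perm_cons.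
Qed.

(** * Fill-closed sets and the invariants of moves *)

Definition fill_closed (U : int * int -> Prop) : Prop :=
  forall v p q r, p \in translate v T -> q \in translate v T ->
    r \in translate v T -> p != q -> U p -> U q -> U r.

Definition spans (P : pattern) (A : pattern) : Prop :=
  forall U, fill_closed U -> (forall p, p \in P -> U p) ->
    forall p, p \in A -> U p.

(** Two triangles holding points of one translate of [T] touch, hence coincide; a triangle holding
    two points of the translate holds the third. *)
Lemma fill_closed_separated s : separated s ->
  fill_closed (fun p => exists2 e, e \in s & in_tri e.2 p).
Proof.
move=> [_ ns] v p q r pv qv rv pq [e es ep] [f fs fq]; exists e => //.
have ef := ns _ _ es fs (touch_translate pv qv ep fq).
move: pv qv rv pq ep fq; rewrite -ef; case: (e.2) => [[a b] c].
case: v p q r => [x y] [i j] [i' j'] [k l].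
rewrite !in_translateT /in_tri !xpair_eqE /=; lia.
Qed.

Lemma in_L n p : (p \in L n) = [&& 0 <= p.1, p.1 < n%:Z & p.2 == 0].
Proof.
case: p => [i j]; apply/imfsetP/idP => [[a] /=|/=].
  rewrite mem_iota => ha [-> ->]; lia.
move=> h; exists `|i|%N => /=; first by rewrite mem_iota; lia.
by congr (_, _); lia.
Qed.

Lemma cardL n : #|` L n| = n.
Proof.
rewrite card_imfset /=; last by move=> a b [].
by rewrite undup_id ?iota_uniq// size_iota.
Qed.

Lemma move_card P Q : solitaire_move P Q -> #|` Q| = #|` P|.
Proof.
move=> [v [S [h2 sS cS ->]]].
rewrite -(cardfsID (translate v T) P) h2 cardfsU cS.
have -> : (P `\` translate v T) `&` S = fset0.
  apply/fsetP => p; rewrite !inE; apply/negP => /andP[/andP[/negP pn _] pS].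
  by apply: pn; apply: (fsubsetP sS).
by rewrite cardfs0; lia.
Qed.


(** The two points of [S] force a fill-closed set to contain all of [v + T], including the points
    removed by the move. *)
Lemma move_spans P Q A : solitaire_move P Q -> spans P A -> spans Q A.
Proof.
move=> [v [S [h2 sS cS ->]]] sp U cU QU; apply: sp => // p pP.
case: (boolP (p \in translate v T)) => pv; last by apply: QU; rewrite !inE pv pP.
have [a [b [ab aS bS]]] : exists a b, [/\ a != b, a \in S & b \in S].
  have Smem p' : (p' \in S) = (p' \in enum_fset S) by [].
  move: cS (fset_uniq S) Smem; rewrite /=.
  case: (enum_fset S) => [|a [|b [|? ?]]]//= _.
  rewrite inE andbT => ab Smem; exists a, b.
  by split=> //; rewrite Smem !inE eqxx ?orbT.
apply: (cU v a b) => //; try exact: (fsubsetP sS).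
  by apply: QU; rewrite inE aS orbT.
by apply: QU; rewrite inE bS orbT.
Qed.

Lemma gamma_gen n P : (0 < n)%N -> gamma (L n) P ->
  exists l, [/\ gen l (n%:Z - 1, 0, 0), size l = n & P = [fset p in l]].
Proof.
move=> n_gt0 gP.
have [cP sP] : #|` P| = n /\ spans P (L n).
  suff : forall A B, clos_refl_trans _ solitaire_move A B ->
      #|` A| = n /\ spans A (L n) -> #|` B| = n /\ spans B (L n).
    by apply; [exact: gP|rewrite cardL; split=> // U _].
  move=> A B; elim=> {A B} // [A B mAB [cA sA]|A B C _ IH1 _ IH2 /IH1/IH2//].
  by rewrite (move_card mAB); split=> //; apply: move_spans sA.
have [s ss ps] := separated_exists (enum_fset P).
have LU p : p \in L n -> exists2 e, e \in s & in_tri e.2 p.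
  apply: (sP _ (fill_closed_separated ss)) => {}p.
  have -> : (p \in P) = (p \in enum_fset P) by [].
  rewrite -(perm_mem ps) => /flattenP[l /mapP[e es ->] pe].
  exists e => //; move: pe; have := ss.1 _ es.
  elim=> {e es l} [q|l [[a b] c] k [[d e] f] _ IH1 _ IH2 _].
    by rewrite inE => /eqP ->; rewrite /in_tri /= !lexx.
  by rewrite mem_cat => /orP[/IH1|/IH2]; rewrite /in_tri /=; lia.
have [e es e0] : exists2 e, e \in s & in_tri e.2 (0, 0) by apply: LU; rewrite in_L /=; lia.
(* Neighbouring cells of the row lie in a common translate of [T], so their triangles are equal: one
   triangle contains the whole row. *)
have eL (i : nat) : (i < n)%N -> in_tri e.2 (i%:Z, 0).
  elim: i => // i IH lt_in; have [f fs fi] : exists2 f, f \in s & in_tri f.2 (i.+1%:Z, 0).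
    by apply: LU; rewrite in_L /=; lia.
  rewrite (_ : e.2 = f.2)//; apply: ss.2 => //.
  apply: (@touch_translate (i%:Z, -1) (i%:Z, 0) (i.+1%:Z, 0)) => //; last by apply: IH; lia.
    by rewrite in_translateT !xpair_eqE /=; lia.
  by rewrite in_translateT !xpair_eqE /=; lia.
have := eL n.-1; rewrite ltn_predL => /(_ n_gt0) en.
have ge := ss.1 _ es; have le := gen_size_le ge.
have pe := perm_to_rem es.
have pP : perm_eq (e.1 ++ flatten (map fst (rem e s))) (enum_fset P).
  apply: perm_trans ps; rewrite perm_sym.
  by apply: (perm_trans (perm_flatten (perm_map fst pe))).
have := perm_size pP; rewrite size_cat.
have -> : size (enum_fset P) = n by [].
move=> sz.
(* A triangle containing both ends of the row has size at least [n], yet at most the number of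
   points it uses, itself at most [n]. *)
have [se1 se2] : size e.1 = n /\ size (flatten (map fst (rem e s))) = 0%N.
  move: le en e0 sz n_gt0; case: (e.2) => [[a b] c]; rewrite /tri_size /in_tri /=; lia.
have pP' : perm_eq e.1 (enum_fset P).
  by move: pP; rewrite (size0nil se2) cats0.
exists e.1; split=> //.
  suff -> : (n%:Z - 1, 0, 0) = e.2 by [].
  move: le en e0; rewrite se1; case: (e.2) => [[a b] c]; rewrite /tri_size /in_tri /= => h1 h2 h3.
  by congr (_, _, _); lia.
by apply/fsetP => p; rewrite !inE (perm_mem pP').
Qed.

(** * Enumeration of the tight patterns *)

Definition unions (A B : seq pattern) : seq pattern :=
  [seq P `|` Q | P <- A, Q <- B].

(* Up to exchanging them, the first of two tight touching triangles shares two of the three bounds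
   of the hull; [p < a] (rather than [p <= a]) keeps one of the two labellings when both do. *)
Fixpoint tight_patterns (f k : nat) (t : triangle) : seq pattern :=
  if f is f'.+1 then
    let: (X, Y, W) := t in
    if k == 1%N then [:: [fset (X, Y)]] else
    flatten [seq flatten [seq
        unions (tight_patterns f' a (X, Y, W + (k - a)%:Z))
               (tight_patterns f' (k - a) (X - p%:Z, Y - (a - p)%:Z, W))
     ++ unions (tight_patterns f' a (X - (k - a)%:Z, Y, W))
               (tight_patterns f' (k - a) (X, Y - p%:Z, W + (a - p)%:Z))
     ++ unions (tight_patterns f' a (X, Y - (k - a)%:Z, W))
               (tight_patterns f' (k - a) (X - (a - p)%:Z, Y, W + p%:Z))
      | p <- iota 0 a] | a <- iota 1 k.-1]
  else [::].

Fixpoint tight_count (f k : nat) : nat :=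
  if f is f'.+1 then
    if k == 1%N then 1 else
    \sum_(a <- iota 1 k.-1) 3 * a * (tight_count f' a * tight_count f' (k - a))
  else 0.

Lemma size_tight_patterns f k t : size (tight_patterns f k t) = tight_count f k.
Proof.
elim: f k t => // f IH k [[X Y] W] /=; case: eqP => // _.
rewrite size_flatten /shape -map_comp sumnE big_map.
apply: eq_bigr => a _ /=.
rewrite size_flatten /shape -map_comp sumnE big_map.
under eq_bigr => p _ do rewrite /= !size_cat !size_allpairs !IH.
rewrite big_const_seq count_predT size_iota iter_addn_0; lia.
Qed.

Lemma tight_count_fuel f k : (k <= f)%N -> tight_count f k = tight_count k k.
Proof.
elim/ltn_ind: f k => -[|f] IH [|k] //= le_kf; first by rewrite big_nil.
case: eqP => // _; apply: eq_big_seq => a; rewrite mem_iota => ha.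
have E g : (k <= g <= f)%N -> forall b, (b <= k)%N -> tight_count g b = tight_count b b.
  by move=> /andP[kg gf] b bk; apply: IH; lia.
by rewrite !(E f) ?(E k)//; lia.
Qed.

(** In each case [t] shares two bounds with [h] and retracts the third by [b], the size of [u]; [u]
    shares that third bound and retracts the other two by [p] and [a - p]. *)
Definition placement (a b p : nat) (h t u : triangle) : bool :=
  let: (X, Y, W) := h in
  [|| (t, u) == ((X, Y, W + b%:Z), (X - p%:Z, Y - (a - p)%:Z, W)),
      (t, u) == ((X - b%:Z, Y, W), (X, Y - p%:Z, W + (a - p)%:Z))
    | (t, u) == ((X, Y - b%:Z, W), (X - (a - p)%:Z, Y, W + p%:Z))].

Lemma tight_placement a b t u : (0 < a)%N -> (0 < b)%N ->
  tri_size t = a%:Z -> tri_size u = b%:Z -> tri_size (tri_meet t u) = 0 ->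
  (exists2 p, (p < a)%N & placement a b p (hull t u) t u) \/
  (exists2 p, (p < b)%N & placement b a p (hull t u) u t).
Proof.
case: t u => [[X Y] W] [[X' Y'] W']; rewrite /placement /tri_size /tri_meet /hull /=.
move=> a0 b0 ta ub m0.
(* Sizes are positive and the meet has size 0, so neither triangle contains the other: one prevails
   in two bounds, the other in the third. Strictness in one of the two bounds makes the offset small
   enough. *)
have : [|| [&& X' <= X, Y' < Y & W' < W], [&& Y' <= Y, W < W' & X < X'],
           [&& W <= W', X' < X & Y < Y'], [&& X <= X', Y < Y' & W < W'],
           [&& Y <= Y', W' < W & X' < X] | [&& W' <= W, X < X' & Y' < Y]] by lia.
case/or4P => [h|h|h|/or3P[h|h|h]].
- by left; exists `|X - X'|%N; rewrite ?xpair_eqE; lia.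
- by left; exists `|Y - Y'|%N; rewrite ?xpair_eqE; lia.
- by left; exists `|W - W'|%N; rewrite ?xpair_eqE; lia.
- by right; exists `|X - X'|%N; rewrite ?xpair_eqE; lia.
- by right; exists `|Y - Y'|%N; rewrite ?xpair_eqE; lia.
- by right; exists `|W - W'|%N; rewrite ?xpair_eqE; lia.
Qed.

Lemma tight_patternsU f a b p h t u A B : (0 < a)%N -> (0 < b)%N -> (p < a)%N ->
  placement a b p h t u ->
  A \in tight_patterns f a t -> B \in tight_patterns f b u ->
  A `|` B \in tight_patterns f.+1 (a + b) h.
Proof.
case: h => [[X Y] W] a0 b0 pa pl hA hB /=.
rewrite ifF; last by apply/eqP; lia.
apply/flattenP; eexists; first by apply: (map_f _ (x := a)); rewrite mem_iota; lia.
apply/flattenP; eexists; first by apply: (map_f _ (x := p)); rewrite mem_iota; lia.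
rewrite addKn !mem_cat.
have mU C D : A \in C -> B \in D -> A `|` B \in unions C D.
  by move=> AC BD; apply/allpairsP; exists (A, B).
by case/or3P: pl => /eqP[et eu]; rewrite et eu in hA hB; rewrite (mU _ _ hA hB) ?orbT.
Qed.

(** No triangle is larger than its list and no meet has negative size, so a tight hull forces both
    parts to be tight and their meet to have size 0. *)
Lemma gen_tight_patterns f l t : gen l t -> tri_size t = (size l)%:Z ->
  (size l <= f)%N -> [fset p in l] \in tight_patterns f (size l) t.
Proof.
move=> gl; elim: gl f => {l t} [[i j]|l t k u gl IHl gk IHk tu] f.
  case: f => // f _ _ /=; rewrite inE; apply/eqP/fsetP => p; by rewrite !inE orbF.
have := gen_size_le gl; have := gen_size_le gk; have := gen_size_gt0 gl; have := gen_size_gt0 gk.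
move: tu; rewrite /touch tri_size_hull size_cat => tu k0 l0 kk ll tight.
have {}l0 : (0 < size l)%N by lia.
have {}k0 : (0 < size k)%N by lia.
have el : tri_size t = (size l)%:Z by lia.
have ek : tri_size u = (size k)%:Z by lia.
have m0 : tri_size (tri_meet t u) = 0 by lia.
case: f => [|f] hf; first by lia.
have {}IHl := IHl f el (ltac:(lia)); have {}IHk := IHk f ek (ltac:(lia)).
have eU : [fset p in l ++ k] = [fset p in l] `|` [fset p in k].
  by apply/fsetP => p; rewrite !inE ?mem_cat.
rewrite eU; case: (tight_placement l0 k0 el ek m0) => -[p hp pl].
  exact: (tight_patternsU _ _ hp pl).
by rewrite fsetUC addnC; apply: (tight_patternsU _ _ hp pl).
Qed.

Lemma gamma_tight_patterns n P : (0 < n)%N -> gamma (L n) P ->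
  P \in tight_patterns n n (n%:Z - 1, 0, 0).
Proof.
move=> n0 /(gamma_gen n0)[l [gl sl ->]].
by rewrite -{1 2}sl; apply: gen_tight_patterns => //; rewrite sl /tri_size/=; lia.
Qed.

Lemma gamma_L_finite n : (0 < n)%N -> finite_set (gamma (L n)).
Proof.
move=> n0; apply: sub_finite_set (finite_seq (tight_patterns n n (n%:Z - 1, 0, 0))).
by move=> P /gamma_tight_patterns; apply.
Qed.

Lemma card_gamma_L_le n : (0 < n)%N ->
  (#|` fset_set (gamma (L n))| <= tight_count n n)%N.
Proof.
move=> n0; rewrite -(size_tight_patterns n n (n%:Z - 1, 0, 0)).
apply: uniq_leq_size (fset_uniq _) _ => P.
have -> : (P \in enum_fset (fset_set (gamma (L n)))) = (P \in fset_set (gamma (L n))) by [].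
by rewrite in_fset_set ?inE; [exact: gamma_tight_patterns|exact: gamma_L_finite].
Qed.

(** * Reachable patterns with one point per row *)

Definition segment (x y : int) (n : nat) : pattern :=
  [fset (x + i%:Z, y) | i in iota 0 n].

Lemma in_segment x y n p :
  (p \in segment x y n) = [&& x <= p.1, p.1 < x + n%:Z & p.2 == y].
Proof.
case: p => [i j]; apply/imfsetP/idP => [[a] /=|/=].
  rewrite mem_iota => ha [-> ->]; lia.
move=> h; exists `|i - x|%N => /=; first by rewrite mem_iota; lia.
by congr (_, _); lia.
Qed.

Lemma solitaire_move_swap (v p q r : int * int) (P Q : pattern) :
  translate v T = [fset p; q; r] -> p != q -> p != r -> q != r ->
  p \in P -> q \in P -> r \notin P -> Q =i r |` (P `\ p) ->
  solitaire_move P Q.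
Proof.
move=> eT pq pr qr pP qP rP eQ; exists v, [fset q; r]; split.
- suff -> : P `&` translate v T = [fset p; q] by rewrite cardfs2 pq.
  rewrite eT; apply/fsetP => z; rewrite !inE.
  case: (eqVneq z p) => [->|_]; first by rewrite pP.
  case: (eqVneq z q) => [->|_]; first by rewrite qP.
  by case: (eqVneq z r) => [->|_] /=; rewrite ?(negbTE rP) ?andbF.
- by rewrite eT; apply/fsubsetP => z; rewrite !inE => /orP[] ->; rewrite ?orbT.
- by rewrite cardfs2 qr.
apply/fsetP => z; rewrite eQ eT !inE.
case: (eqVneq z p) => [->|_]; first by rewrite (negbTE pq) (negbTE pr).
case: (eqVneq z q) => [->|_]; first by rewrite qP /= orbT.
by case: (eqVneq z r) => _ /=; rewrite ?orbT ?orbF.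
Qed.

Lemma translateT_fset x y :
  translate (x, y) T = [fset (x, y + 1); (x + 1, y + 1); (x + 1, y)].
Proof. by apply/fsetP => z; rewrite in_translateT !inE orbA. Qed.

(* The cells [l..r] of the row [y] are still occupied, and the cells of the row below that a full
   row of length [n.+1] leaves behind have already been produced on both sides. *)
Definition half_lowered (F : pattern) (x y : int) (n l r : nat) : pattern :=
  F `|` segment (x + l%:Z) y (r - l).+1 `|` segment (x + 1) (y - 1) l
    `|` segment (x + r%:Z + 1) (y - 1) (n - r).

Lemma lower_left F x y n l r : (forall p, p \in F -> y < p.2) ->
  (l < r <= n)%N ->
  solitaire_move (half_lowered F x y n l r) (half_lowered F x y n l.+1 r).
Proof.
move=> hF lr.
apply: (@solitaire_move_swap (x + l%:Z, y - 1)
  (x + l%:Z, y) (x + l%:Z + 1, y) (x + l%:Z + 1, y - 1)).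
- by rewrite translateT_fset subrK.
- by rewrite xpair_eqE; lia.
- by rewrite xpair_eqE; lia.
- by rewrite xpair_eqE; lia.
- by rewrite !inE !in_segment /=; lia.
- by rewrite !inE !in_segment /=; lia.
- rewrite !inE !in_segment /=; case: (boolP (_ \in F)) => [/hF/=|_]; lia.
move=> [i j]; rewrite !inE !in_segment !xpair_eqE /=.
case: (boolP (_ \in F)) => [/hF/=|_]; lia.
Qed.

Lemma lower_right F x y n l r : (forall p, p \in F -> y < p.2) ->
  (l <= r < n)%N ->
  solitaire_move (half_lowered F x y n l r.+1) (half_lowered F x y n l r).
Proof.
move=> hF lr.
apply: (@solitaire_move_swap (x + r%:Z, y - 1)
  (x + r%:Z + 1, y) (x + r%:Z, y) (x + r%:Z + 1, y - 1)).
- by rewrite translateT_fset subrK; apply/fsetP => z; rewrite !inE (orbC (z == (x + r%:Z, y))).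
- by rewrite xpair_eqE; lia.
- by rewrite xpair_eqE; lia.
- by rewrite xpair_eqE; lia.
- by rewrite !inE !in_segment /=; lia.
- by rewrite !inE !in_segment /=; lia.
- rewrite !inE !in_segment /=; case: (boolP (_ \in F)) => [/hF/=|_]; lia.
move=> [i j]; rewrite !inE !in_segment !xpair_eqE /=.
case: (boolP (_ \in F)) => [/hF/=|_]; lia.
Qed.

(** The cells left of [c] drop diagonally, starting at the left end; then those right of [c] drop
    straight down, starting at the right end. [F] lies higher and does not interfere. *)
Lemma lower_row F x y n c : (forall p, p \in F -> y < p.2) -> (c <= n)%N ->
  clos_refl_trans _ solitaire_move (F `|` segment x y n.+1)
    ((F `|` [fset (x + c%:Z, y)]) `|` segment (x + 1) (y - 1) n).
Proof.
move=> hF cn.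
have -> : F `|` segment x y n.+1 = half_lowered F x y n 0 n.
  apply/fsetP => -[i j]; rewrite !inE !in_segment /=.
  by case: (_ \in F) => //=; lia.
have -> : (F `|` [fset (x + c%:Z, y)]) `|` segment (x + 1) (y - 1) n =
    half_lowered F x y n c c.
  apply/fsetP => -[i j]; rewrite !inE !in_segment !xpair_eqE /=.
  by case: (_ \in F) => //=; lia.
apply: (@rt_trans _ _ _ (half_lowered F x y n c n)).
  elim: c cn => [|c IH] cn; first exact: rt_refl.
  apply: rt_trans (IH (ltnW cn)) _.
  by apply: rt_step; apply: lower_left => //; rewrite cn leqnn.
suff : forall d, (d <= n - c)%N -> clos_refl_trans _ solitaire_move
    (half_lowered F x y n c n) (half_lowered F x y n c (n - d)).
  by move=> /(_ _ (leqnn _)); rewrite subKn.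
elim=> [|d IH] hd; first by rewrite subn0; exact: rt_refl.
apply: rt_trans (IH (ltnW hd)) _; apply: rt_step.
have -> : (n - d = (n - d.+1).+1)%N by lia.
by apply: lower_right => //; lia.
Qed.

Fixpoint one_per_row (n : nat) (x y : int) : seq pattern :=
  if n is m.+1 then
    [seq (x + c%:Z, y) |` Q | c <- iota 0 n, Q <- one_per_row m (x + 1) (y - 1)]
  else [:: fset0].

Lemma size_one_per_row n x y : size (one_per_row n x y) = n`!.
Proof.
elim: n x y => // n IH x y.
by rewrite /one_per_row -/one_per_row size_allpairs size_iota IH factS.
Qed.

Lemma one_per_row_le n x y Q (p : int * int) :
  Q \in one_per_row n x y -> p \in Q -> p.2 <= y.
Proof.
elim: n x y Q => [|n IH] x y Q; first by rewrite inE => /eqP ->; rewrite inE.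
move=> /allpairsP[[c Q'] /= [_ hQ ->]]; rewrite !inE => /orP[/eqP -> //|pQ].
by apply: le_trans (IH _ _ _ hQ pQ) _; lia.
Qed.

(** The only point in the row [y] reveals [c]; all others lie lower, so deleting it recovers the
    rest. *)
Lemma one_per_row_uniq n x y : uniq (one_per_row n x y).
Proof.
elim: n x y => // n IH x y; rewrite /one_per_row -/one_per_row.
apply: allpairs_uniq; [exact: iota_uniq|exact: IH|].
move=> [c Q] [d Q'] /allpairsP[[c1 Q1] [_ hQ [-> ->]]].
move=> /allpairsP[[d1 Q2] [_ hQ' [-> ->]]] /= /fsetP E.
rewrite /= in hQ hQ' *.
have low A (i : int) : A \in one_per_row n (x + 1) (y - 1) -> (i, y) \notin A.
  by move=> hA; apply/negP => /(one_per_row_le hA) /=; lia.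
have cd : c1 = d1.
  have := E (x + c1%:Z, y); rewrite !inE eqxx /= (negbTE (low _ _ hQ')) orbF.
  by rewrite xpair_eqE; lia.
rewrite cd in E *; congr (_, _); apply/fsetP => p; have := E p; rewrite !inE.
by case: eqVneq => //= -> _; rewrite (negbTE (low _ _ hQ)) (negbTE (low _ _ hQ')).
Qed.

Lemma one_per_row_reachable n x y F Q : (forall p, p \in F -> y < p.2) ->
  Q \in one_per_row n x y ->
  clos_refl_trans _ solitaire_move (F `|` segment x y n) (F `|` Q).
Proof.
elim: n x y F Q => [|n IH] x y F Q hF.
  rewrite inE => /eqP ->.
  have -> : segment x y 0 = fset0 by apply/fsetP => p; rewrite in_segment inE; lia.
  exact: rt_refl.
move=> /allpairsP[[c Q'] /= [hc hQ ->]].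
apply: rt_trans (lower_row x (n := n) (c := c) hF _) _.
  by move: hc; rewrite inE mem_iota; lia.
rewrite fsetUA; apply: IH => // p; rewrite !inE => /orP[/hF|/eqP ->] /=; lia.
Qed.

Lemma one_per_row_gamma n Q : Q \in one_per_row n 0 0 -> gamma (L n) Q.
Proof.
move=> hQ; have /(_ fset0) := one_per_row_reachable _ hQ.
rewrite !fset0U (_ : segment 0 0 n = L n); first by apply=> p; rewrite inE.
by apply/fsetP => p; rewrite in_segment.
Qed.

Lemma card_gamma_L_ge n : finite_set (gamma (L n)) ->
  (n`! <= #|` fset_set (gamma (L n))|)%N.
Proof.
move=> fin; rewrite -(size_one_per_row n 0 0).
apply: uniq_leq_size (one_per_row_uniq _ _ _) _ => P /one_per_row_gamma gP.
have -> : (P \in enum_fset (fset_set (gamma (L n)))) = (P \in fset_set (gamma (L n))) by [].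
by rewrite in_fset_set// inE.
Qed.

(** * Stirling-type bounds on factorials *)

Lemma series_exp_coeff_le (R : realType) (x : R) n : 0 <= x ->
  series (exp_coeff x) n <= expR x.
Proof.
move=> x0; rewrite /expR; apply: nondecreasing_cvgn_le; last exact: is_cvg_series_exp_coeff.
by apply: nondecreasing_series => k _ _; rewrite exp_coeff_ge0.
Qed.

Lemma fact_stirling_ge (R : realType) n : (0 < n)%N ->
  expR (- n%:R) * n%:R `^ (n%:R + 1 / 2) <= n`!%:R :> R.
Proof.
move=> n_gt0.
(* The bare bound is not inductive, since (1 + 1 / n) ^ (n + 1 / 2) > e; the extra factor e ^ (1 /
   n) repairs this and gives equality at n = 1. *)
suff H : expR (n%:R^-1 - n%:R) * n%:R `^ (n%:R + 1 / 2) <= n`!%:R :> R.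
  apply: le_trans H; rewrite ler_wpM2r ?powR_ge0// ler_expR lerDr.
  by rewrite invr_ge0.
elim: n n_gt0 => // [[|n]] IH _.
  by rewrite invr1 subrr expR0 powR1 mulr1.
move: IH => /(_ isT); set m := n.+1 => IH.
have m0 : 0 < m%:R :> R by rewrite ltr0n.
have m10 : 0 < m.+1%:R :> R by rewrite ltr0n.
rewrite factS natrM.
pose x : R := m%:R.
(* Chosen so that z (x + 1 / 2) = 1 + 1 / x - 1 / (x + 1), the exponent needed in the induction
   step; 1 + z + z ^ 2 / 2 already exceeds 1 + 1 / x. *)
pose z : R := 2 * (x ^+ 2 + x + 1) / (x * (x + 1) * (2 * x + 1)).
have x0 : 0 < x by [].
have z0 : 0 <= z by rewrite divr_ge0//; nra.
have hz : 1 + x^-1 <= expR z.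
  apply: le_trans (series_exp_coeff_le 3 z0).
  rewrite /series /= !big_nat_recr//= big_nil /exp_coeff /= !expr0 !expr1.
  have -> : 0 + 1 / 0`!%:R + z / 1`!%:R + z ^+ 2 / 2`!%:R = 1 + z + z ^+ 2 / 2 :> R.
    by rewrite fact0 (_ : 1`! = 1)// (_ : 2`! = 2)// add0r !divr1.
  rewrite -addrA lerD2l -subr_ge0.
  have -> : z + z ^+ 2 / 2 - x^-1 =
      (3 * x ^+ 3 + 8 * x ^+ 2 + 5 * x + 2) / (x * (x + 1) * (2 * x + 1)) ^+ 2.
    rewrite /z; field.
    by rewrite !gt_eqF//; nra.
  by rewrite divr_ge0// ?exprn_ge0//; nra.
have e1 : m.+1%:R = x + 1 :> R by rewrite -natr1.
rewrite e1 (_ : x + 1 + 1 / 2 = 1 + (x + 1 / 2)); last by ring.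
rewrite powRD; last by apply/implyP => _; apply/lt0r_neq0; lra.
rewrite powRr1; last by lra.
have -> : (x + 1) `^ (x + 1 / 2) = x `^ (x + 1 / 2) * (1 + x^-1) `^ (x + 1 / 2).
  rewrite -powRM ?addr_ge0 ?invr_ge0 ?ltW//; congr (_ `^ _).
  by field; rewrite gt_eqF.
have hp : (1 + x^-1) `^ (x + 1 / 2) <= expR (1 + x^-1 - (x + 1)^-1).
  apply: (@le_trans _ _ (expR z `^ (x + 1 / 2))).
    apply: ge0_ler_powR => //; rewrite ?nnegrE ?expR_ge0//; first by lra.
    by rewrite addr_ge0// invr_ge0 ltW.
  rewrite -expRM ler_expR le_eqVlt; apply/orP; left; apply/eqP.
  by rewrite /z; field; rewrite !gt_eqF//; lra.
have -> : expR ((x + 1)^-1 - (x + 1)) =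
    expR (x^-1 - x) / expR (1 + x^-1 - (x + 1)^-1).
  by rewrite -expRN -expRD; congr expR; ring.
have E0 := expR_gt0 (1 + x^-1 - (x + 1)^-1).
move: hp E0; set E := expR (1 + _ - _); set Q := (1 + _) `^ _ => hp E0.
have -> : expR (x^-1 - x) / E * ((x + 1) * (x `^ (x + 1 / 2) * Q)) =
   (x + 1) * (expR (x^-1 - x) * x `^ (x + 1 / 2) * (Q / E)) by ring.
rewrite ler_wpM2l//; first by lra.
apply: le_trans IH; rewrite ler_piMr ?mulr_ge0 ?expR_ge0 ?powR_ge0//.
by rewrite ler_pdivrMr// mul1r.
Qed.

Lemma fact_stirling_le (R : realType) n : (0 < n)%N ->
  n`!%:R <= expR 1 * n%:R * (n%:R / expR 1) ^+ n :> R.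
Proof.
case: n => // n _; elim: n => [|n IH].
  by rewrite mulr1 expr1 mul1r divff// gt_eqF ?expR_gt0.
rewrite factS natrM; set x : R := n.+1%:R in IH *.
have x0 : 0 < x by rewrite ltr0n.
have -> : n.+2%:R = x + 1 :> R by rewrite natr1.
apply: (le_trans (ler_wpM2l _ IH)); first by lra.
have E0 := expR_gt0 (1 : R).
(* From 1 - t <= exp (- t) at t = 1 / (x + 1), raised to the power n + 2 = x + 1. *)
have h : (x / (x + 1)) ^+ n.+2 <= (expR 1)^-1.
  apply: (@le_trans _ _ (expR (- (x + 1)^-1) ^+ n.+2)).
    rewrite ler_pXn2r ?nnegrE ?expR_ge0 ?divr_ge0//; try lra.
    apply: le_trans (expR_ge1Dx _); rewrite le_eqVlt; apply/orP; left; apply/eqP.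
    by field; rewrite gt_eqF//; lra.
  rewrite -expRM_natl -expRN ler_expR -natr1 -/x mulrN divff//.
  by rewrite gt_eqF//; lra.
have -> : (x + 1) * (expR 1 * x * (x / expR 1) ^+ n.+1) =
  (x + 1) * (expR 1 * expR 1 * (((x + 1) / expR 1) ^+ n.+2 * (x / (x + 1)) ^+ n.+2)).
  rewrite -exprMn (_ : (x + 1) / expR 1 * (x / (x + 1)) = x / expR 1).
    by rewrite [in RHS]exprS; field; rewrite gt_eqF.
  by field; rewrite !gt_eqF//; lra.
apply: (@le_trans _ _ ((x + 1) * (expR 1 * expR 1 * (((x + 1) / expR 1) ^+ n.+2 * (expR 1)^-1)))).
  apply: ler_wpM2l; first by lra.
  apply: ler_wpM2l; first by rewrite mulr_ge0 ?expR_ge0.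
  by apply: ler_wpM2l => //; rewrite exprn_ge0// divr_ge0 ?expR_ge0//; lra.
rewrite le_eqVlt; apply/orP; left; apply/eqP.
by field; rewrite gt_eqF.
Qed.

(** * Growth of the quadratic recurrence *)

Lemma leq_fact3 i j : (i.+3`! * j.+3`! <= 6 * (i + j).+3`!)%N.
Proof.
elim: i => [|i IH]; first by rewrite add0n.
rewrite (factS i.+3) addSn (factS (i + j).+3) -mulnA [leqRHS]mulnCA.
by apply: leq_mul => //; rewrite !ltnS leq_addr.
Qed.

(** For [n >= 5] the terms [a = 2] and [a = n - 2] are split off; each of the other [n - 5] is at
    most 6 (n - 3)!. The ratio 11 / 10 is attained at [n = 6]. *)
Lemma sum_fact_fact_le n : (3 <= n)%N ->
  (10 * \sum_(2 <= a < n.-1) a`! * (n - a)`! <= 11 * n.-1`!)%N.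
Proof.
move=> n3.
have [n_lt5|n5] := ltnP n 5.
  have [->|->] : n = 3 \/ n = 4 by lia.
    by rewrite big_geq.
  by rewrite big_nat1.
have -> : n = (n - 5).+4.+1 by lia.
move: (n - 5)%N => {n3 n5}n; rewrite [_.-1]/=.
rewrite big_ltn // big_nat_recr //=.
have S : (\sum_(3 <= i < n.+3) i`! * (n.+4.+1 - i)`! <= n * (6 * n.+2`!))%N.
  apply: (@leq_trans (\sum_(3 <= i < n.+3) 6 * n.+2`!)).
    rewrite big_nat [leqRHS]big_nat; apply: leq_sum => a ha; have := leq_fact3 (a - 3) (n.+2 - a).
    have -> : (a - 3).+3 = a by lia.
    have -> : (n.+2 - a).+3 = (n.+4.+1 - a)%N by lia.
    by have -> : (a - 3 + (n.+2 - a)).+3 = n.+2 by lia.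
  by rewrite sum_nat_const_nat (_ : (n.+3 - 3 = n)%N)//; lia.
have -> : (n.+4.+1 - 2 = n.+3)%N by lia.
have -> : (n.+4.+1 - n.+3 = 2)%N by lia.
rewrite (factS n.+3) (factS n.+2); move: S; move: (\sum_(_ <= _ < _) _)%N => S.
have -> : 2`! = 2%N by [].
have : (0 < n.+2`!)%N by rewrite fact_gt0.
move: (n.+2`!)%N => F F0 hS.
case: n hS => [|n] hS; first by lia.
case: n hS => [|n] hS; first by lia.
nia.
Qed.

(* The constant [b = 147 / 40] is just large enough for [3 b ^ 2 >= 9 b + 297 / 40], which the
   induction needs, and must satisfy [2 b < e ^ 2] for the theorem. *)
Lemma quadratic_recurrence_le (R : realType) (N : nat -> R) :
  (forall k, 0 <= N k) -> N 1%N <= 1 ->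
  (forall k, (2 <= k)%N ->
     N k <= \sum_(1 <= a < k) 3 * a%:R * (N a * N (k - a)%N)) ->
  forall k, (2 <= k)%N -> N k * (147 / 40) ^+ 2 <= 3 / 2 * (147 / 40) ^+ k * k`!%:R.
Proof.
move=> N0 N1 rec; pose b : R := 147 / 40; rewrite -/b.
have b2 : 0 < b ^+ 2 by rewrite exprn_gt0// /b; lra.
(* Adding the sum to its reversal turns the weight [a] into a + (k - a) = k. *)
have sym k : (2 <= k)%N -> 2 * N k <= 3 * k%:R * \sum_(1 <= a < k) N a * N (k - a)%N.
  move=> k2.
  rewrite mulr_sumr mulr2n mulrDl mul1r; apply: (le_trans (lerD (rec k k2) (rec k k2))).
  rewrite {2}big_nat_rev /= -big_split /=.
  rewrite le_eqVlt; apply/orP; left; apply/eqP.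
  apply: eq_big_nat => a /andP[a1 ak].
  rewrite add1n subSS subKn; last by lia.
  rewrite natrB; last by lia.
  ring.
elim/ltn_ind => k IH k2.
(* This case fixes the factor [3 / 2]: N 2 <= 3 = (3 / 2) 2!. *)
have [->|k3] : k = 2%N \/ (3 <= k)%N by lia.
  have := sym 2%N isT; rewrite big_nat1 (_ : (2 - 1 = 1)%N)// (_ : 2`! = 2%N)// => h.
  have h1 : N 1%N * N 1%N <= 1 by rewrite mulr_ile1 ?N0.
  have {h h1} : N 2%N <= 3 by lra.
  by rewrite -(ler_pM2r b2); lra.
have hs := sym k k2.
(* The induction hypothesis starts at index 2, so the two terms with [N 1] are treated apart, using
   [N 1 <= 1]. *)
have e : \sum_(1 <= a < k) N a * N (k - a)%N =
    2 * (N 1%N * N k.-1) + \sum_(2 <= a < k.-1) N a * N (k - a)%N.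
  rewrite big_ltn; last by lia.
  have kE : k = k.-1.+1 by lia.
  rewrite [X in \sum_(_ <= _ < X) _]kE.
  rewrite big_nat_recr /=; last by lia.
  have -> : (k - k.-1 = 1)%N by lia.
  have -> : (k - 1 = k.-1)%N by lia.
  ring.
rewrite e in hs.
have S : (\sum_(2 <= a < k.-1) N a * N (k - a)%N) * b ^+ 4 <=
    (3 / 2) ^+ 2 * b ^+ k * (\sum_(2 <= a < k.-1) a`! * (k - a)`!)%:R.
  rewrite natr_sum mulr_sumr mulr_suml; apply: ler_sum_nat => a ha.
  have h1 := IH a (ltac:(lia)) (ltac:(lia)).
  have h2 := IH (k - a)%N (ltac:(lia)) (ltac:(lia)).
  have -> : N a * N (k - a)%N * b ^+ 4 = (N a * b ^+ 2) * (N (k - a)%N * b ^+ 2) by ring.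
  have Nb c : 0 <= N c * b ^+ 2 by rewrite mulr_ge0// ltW.
  apply: (le_trans (ler_pM (Nb _) (Nb _) h1 h2)).
  have -> : b ^+ k = b ^+ a * b ^+ (k - a) by rewrite -exprD subnKC//; lia.
  rewrite natrM.
  by rewrite le_eqVlt; apply/orP; left; apply/eqP; ring.
have F := sum_fact_fact_le k3; rewrite -(ler_nat R) !natrM in F.
move: S F; set S := \sum_(_ <= _ < _) (_ : R); set Q : R := (\sum_(_ <= _ < _) _)%:R.
move=> hS hF.
have h1 := IH k.-1 (ltac:(lia)) (ltac:(lia)).
have ek : k%:R * k.-1`!%:R = k`!%:R :> R.
  by rewrite -natrM; congr _%:R; case: k k3 {k2 IH hs e hS hF h1 S Q} => // k _; rewrite factS.
have eb : b ^+ k = b * b ^+ k.-1 by rewrite -exprS prednK//; lia.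
have k0 : 0 <= k%:R :> R by [].
have hN1 : N 1%N * N k.-1 <= N k.-1 by rewrite ler_piMl.
have b4 : 0 < b ^+ 4 by rewrite exprn_gt0// /b; lra.
rewrite -(ler_pM2r b2).
set G : R := k.-1`!%:R in ek h1 hF.
set B : R := b ^+ k.-1 in eb h1.
have B0 : 0 <= B by rewrite exprn_ge0// /b; lra.
have G0 : 0 <= G by [].
have hS' : S * b ^+ 4 <= 9 / 4 * (b * B) * (11 / 10 * G).
  apply: (le_trans hS); rewrite eb.
  rewrite (_ : (3 / 2) ^+ 2 = 9 / 4); last by field.
  apply: ler_wpM2l; last by lra.
  by rewrite !mulr_ge0// /b; lra.
have hN : (N 1%N * N k.-1) * b ^+ 4 <= 3 / 2 * B * G * b ^+ 2.
  rewrite (_ : b ^+ 4 = b ^+ 2 * b ^+ 2); last by ring.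
  rewrite mulrA ler_pM2r//; apply: le_trans h1.
  by rewrite ler_pM2r.
have : 2 * N k * b ^+ 4 <= 3 * k%:R * (3 * B * G * b ^+ 2 + 9 / 4 * (b * B) * (11 / 10 * G)).
  apply: (@le_trans _ _ (3 * k%:R * ((2 * (N 1%N * N k.-1) + S) * b ^+ 4))).
    by rewrite mulrA ler_wpM2r// ltW.
  apply: ler_wpM2l; first by rewrite mulr_ge0.
  by rewrite mulrDl; apply: lerD => //; lra.
rewrite -ek eb -/B.
have -> : 3 * k%:R * (3 * B * G * b ^+ 2 + 9 / 4 * (b * B) * (11 / 10 * G)) =
  k%:R * B * G * (9 * b ^+ 2 + 297 / 40 * b) by field.
have -> : 3 / 2 * (b * B) * (k%:R * G) * b ^+ 2 = k%:R * B * G * (3 / 2 * b ^+ 3) by ring.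
have -> : N k * b ^+ 2 * b ^+ 2 = N k * b ^+ 4 by ring.
have K0 : 0 <= k%:R * B * G by rewrite !mulr_ge0.
move=> h.
have : k%:R * B * G * (9 * b ^+ 2 + 297 / 40 * b) <= k%:R * B * G * (3 * b ^+ 3).
  by rewrite ler_wpM2l// /b; lra.
lra.
Qed.

(** * Numerical constants and conclusion *)

Lemma tight_count_rec k : (2 <= k)%N -> tight_count k k =
  (\sum_(1 <= a < k) 3 * a * (tight_count a a * tight_count (k - a) (k - a)))%N.
Proof.
case: k => [|[|k]]// _; rewrite /index_iota subn1 /=.
apply: eq_big_seq => a; rewrite inE mem_iota => ha.
by rewrite -!(@tight_count_fuel k.+1)//; lia.
Qed.

Lemma sqr_expR1_gt (R : realType) : 147 / 20 < expR 1 ^+ 2 :> R.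
Proof.
have := @series_exp_coeff_le R 1 6 ler01.
rewrite /series /= !big_nat_recr//= big_nil /exp_coeff /= !expr1n.
rewrite !factS fact0 /= => h.
have {}h : 163 / 60 <= expR 1 :> R by apply: le_trans h; lra.
have : (163 / 60) ^+ 2 <= expR 1 ^+ 2 :> R.
  by rewrite ler_pXn2r ?nnegrE ?expR_ge0//; lra.
by apply: lt_le_trans; lra.
Qed.

(** Apply y <= exp y to y = m ln q / 4 and take fourth powers. *)
Lemma pow4_le_geometric (R : realType) (q : R) : 1 < q ->
  exists2 C : R, 0 < C & forall m : nat, m%:R ^+ 4 <= C * q ^+ m.
Proof.
move=> q1; have d0 := ln_gt0 q1; pose d := ln q; rewrite -/d in d0.
exists ((4 / d) ^+ 4) => [|m]; first by rewrite exprn_gt0// divr_gt0.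
have -> : q ^+ m = expR (d * m%:R / 4) ^+ 4.
  rewrite -expRM_natr -mulrA mulVf// mulr1 expRM_natr lnK// posrE; lra.
have d4 : 0 <= 4 / d by rewrite divr_ge0// ltW.
rewrite -exprMn ler_pXn2r ?nnegrE ?(mulr_ge0 d4) ?expR_ge0//.
have h : d * m%:R / 4 <= expR (d * m%:R / 4) by apply: le_trans (expR_ge1Dx _); lra.
have {1}-> : m%:R = 4 / d * (d * m%:R / 4) by field; rewrite gt_eqF.
by rewrite ler_wpM2l.
Qed.

Theorem theorem5 (R : realType) :
  exists c1 c2 : R, 0 < c1 /\ 0 < c2 /\
    forall n : nat, (2 <= n)%N ->
      finite_set (gamma (L n)) /\
      c1 * expR (- n%:R) * n%:R `^ (n%:R + 1 / 2)
        <= #|` fset_set (gamma (L n))|%:R /\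
      #|` fset_set (gamma (L n))|%:R
        <= c2 * (expR 1 / 2) ^+ n * (n%:R - 1) `^ (n%:R - 5 / 2).
Proof.
pose b : R := 147 / 40; pose e : R := expR 1.
have b0 : 0 < b by rewrite /b; lra.
have e0 : 0 < e by exact: expR_gt0.
(* Beside n ^ n, the recurrence yields the rate [b / e] and the claim allows [e / 2]; their ratio
   exceeds 1, which absorbs a polynomial loss. *)
have q1 : 1 < e ^+ 2 / (2 * b).
  by rewrite ltr_pdivlMr ?mulr_gt0// mul1r; have := sqr_expR1_gt R; rewrite -/e /b; lra.
have [C C0 hC] := pow4_le_geometric q1.
(* For [n = m + 1] and [x = m] the estimates give (3 e / b) (b / e) ^ m x ^ (m + 2); bounding x ^ 4
   by C (e ^ 2 / (2 b)) ^ m leaves (6 C / b) (e / 2) ^ n x ^ (m - 2). *)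
exists 1, (6 * C / b); split=> //; split; first by rewrite divr_gt0// mulr_gt0.
move=> n n2; have n0 : (0 < n)%N by lia.
have fin := gamma_L_finite n0; split=> //; split.
  rewrite mul1r; apply: le_trans (fact_stirling_ge R n0) _.
  by rewrite ler_nat card_gamma_L_ge.
apply: (@le_trans _ _ (tight_count n n)%:R); first by rewrite ler_nat card_gamma_L_le.
have {n0 fin} := @quadratic_recurrence_le R (fun k => (tight_count k k)%:R) _ _ _ n n2.
rewrite -/b => /(_ (fun=> ler0n _ _) (lexx _)) hN.
have {}hN : (tight_count n n)%:R * b ^+ 2 <= 3 / 2 * b ^+ n * n`!%:R.
  apply: hN => k k2; rewrite tight_count_rec// natr_sum ler_sum// => a _.
  by rewrite !natrM.
case: n n2 hN => [|m] // m1 hN; have m0 : (0 < m)%N by lia.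
set x : R := m%:R.
have x0 : 0 < x by rewrite ltr0n.
have x1 : 1 <= x by rewrite ler1n.
have -> : m.+1%:R - 1 = x by rewrite -natr1 addrK.
have -> : m.+1%:R - 5 / 2 = x - 3 / 2 by rewrite -natr1 -/x; field.
have pw : x ^+ m / x ^+ 2 <= x `^ (x - 3 / 2).
  rewrite -(powR_mulrn m (ltW x0)) -/x -(powR_mulrn 2 (ltW x0)) -powRB.
    by rewrite ler_powR//; lra.
  by apply/implyP => _; rewrite gt_eqF.
have hf : m.+1`!%:R <= 2 * x * (e * x * (x ^+ m / e ^+ m)).
  rewrite factS natrM; apply: ler_pM => //.
    by rewrite -natr1 -/x; lra.
  by rewrite -expr_div_n; exact: fact_stirling_le.
have hN' : (tight_count m.+1 m.+1)%:R <= 3 * e / b * b ^+ m * x ^+ 2 * x ^+ m / e ^+ m.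
  have b2 : 0 < b ^+ 2 by rewrite exprn_gt0.
  rewrite -(ler_pM2r b2); apply: (le_trans hN).
  apply: (@le_trans _ _ (3 / 2 * b ^+ m.+1 * (2 * x * (e * x * (x ^+ m / e ^+ m))))).
    by apply: ler_wpM2l hf; rewrite mulr_ge0 ?exprn_ge0 ?ltW//; lra.
  rewrite exprS le_eqVlt; apply/orP; left; apply/eqP.
  by field; rewrite expf_neq0 ?gt_eqF.
apply: (le_trans hN').
have A0 : 0 < b ^+ m by rewrite exprn_gt0.
have E0 : 0 < e ^+ m by rewrite exprn_gt0.
have M0 : 0 < x ^+ m by rewrite exprn_gt0.
have T0 : 0 < (2 : R) ^+ m by rewrite exprn_gt0.
apply: (@le_trans _ _ (6 * C / b * (e / 2) ^+ m.+1 * (x ^+ m / x ^+ 2))); last first.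
  apply: ler_wpM2l pw; rewrite mulr_ge0 ?exprn_ge0 ?divr_ge0 ?ltW//.
  by rewrite mulr_gt0.
have := hC m; rewrite -/x expr_div_n exprAC (exprMn _ 2 b) => h.
have -> : 6 * C / b * (e / 2) ^+ m.+1 * (x ^+ m / x ^+ 2) =
   (3 * e / b * b ^+ m * x ^+ m / e ^+ m / x ^+ 2) *
     (C * ((e ^+ m) ^+ 2 / (2 ^+ m * b ^+ m))).
  rewrite expr_div_n !exprS; field.
  by rewrite !gt_eqF.
have -> : 3 * e / b * b ^+ m * x ^+ 2 * x ^+ m / e ^+ m =
   (3 * e / b * b ^+ m * x ^+ m / e ^+ m / x ^+ 2) * x ^+ 4.
  by field; rewrite !gt_eqF.
apply: ler_wpM2l h.
apply/ltW; rewrite divr_gt0 ?exprn_gt0// divr_gt0//.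
by rewrite mulr_gt0// mulr_gt0// divr_gt0// mulr_gt0.
Qed.
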